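(* Let $M\ge 2$ be an integer and $n\ge 2$ an even integer, let $(\mathcal X,\mu)$ be a measure space, let $p_1,\dots,p_M$ be arbitrary probability densities on $\mathcal X$ with respect to $\mu$, and let $\mathcal P=\operatorname{conv}\{p_1,\dots,p_M\}$ be the set of all mixtures $\sum_{j=1}^M\theta_jp_j$ with $\theta_j\ge0$, $\sum_{j=1}^M\theta_j=1$. There exists a density estimator $\widehat p=\widehat p(X_1,\dots,X_n)$ such that for every $p^\star\in\mathcal P$, if $X_1,\dots,X_n$ are i.i.d. with density $p^\star$, then $$\mathbf E\big[\mathrm{KL}(p^\star,\widehat p)\big]\le 11000000\,\frac{M}{n}.$$
   Context: For probability densities $p,q$ on $(\mathcal X,\mu)$, $\mathrm{KL}(p,q)=\int_{\mathcal X}p\log(p/q)\,d\mu\in[0,+\infty]$ (equal to $+\infty$ if $p$ is not absolutely continuous with respect to $q$). A density estimator is a map from samples in $\mathcal X^n$ to probability densities on $(\mathcal X,\mu)$; it may depend on $p_1,\dots,p_M$ and $n$, but not on $p^\star$. $\log$ is the natural logarithm. *)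

(* Defs.v *)
From HB Require Import structures.
From mathcomp Require Import all_boot all_order all_algebra.
From mathcomp Require Import all_classical all_reals all_analysis.

Set Implicit Arguments.
Unset Strict Implicit.
Unset Printing Implicit Defensive.

Import Order.TTheory GRing.Theory Num.Theory.
Import numFieldNormedType.Exports.

Local Open Scope classical_set_scope.
Local Open Scope ring_scope.

Definition prob_density d (T : measurableType d) (R : realType)
    (mu : {measure set T -> \bar R}) (p : T -> R) : Prop :=
  [/\ measurable_fun [set: T] p,
      forall x, 0 <= p x &
      (\int[mu]_x (p x)%:E = 1)%E].

Definition density_law d (T : measurableType d) (R : realType)
    (mu : {measure set T -> \bar R}) (p : T -> R) (A : set T) : \bar R :=
  (\int[mu]_(x in A) (p x)%:E)%E.

(* Since 0 * _ = 0, the integrand vanishes where p = 0. Absolute continuity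
   forces q > 0 mu-almost everywhere on {p > 0}, so the junk values of division
   by 0 and of ln 0 do not affect the integral. *)
Definition KL d (T : measurableType d) (R : realType)
    (mu : {measure set T -> \bar R}) (p q : T -> R) : \bar R :=
  if `[< density_law mu p `<< density_law mu q >]
  then (\int[mu]_x (p x * ln (p x / q x))%:E)%E
  else +oo%E.

Definition mixtures d (T : measurableType d) (R : realType) (M : nat)
    (p : 'I_M -> T -> R) : set (T -> R) :=
  [set f | exists theta : 'I_M -> R,
    [/\ forall j, 0 <= theta j,
        \sum_(j < M) theta j = 1 &
        f = (fun x => \sum_(j < M) theta j * p j x)]].

(* Joint measurability in (sample, point) makes the KL loss a measurable
   function of the sample, so that its expectation is meaningful (the library
   integral is total and would otherwise be only a lower integral). *)
Definition density_estimator d (T : measurableType d) (R : realType)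
    (mu : {measure set T -> \bar R}) (n : nat)
    (phat : n.-tuple T -> T -> R) : Prop :=
  (forall s, prob_density mu (phat s)) /\
  measurable_fun [set: n.-tuple T * T] (fun z => phat z.1 z.2).

Definition mutually_independent d d' (Omega : measurableType d)
    (T : measurableType d') (R : realType) (P : probability Omega R) (n : nat)
    (X : 'I_n -> {RV P >-> T}) : Prop :=
  forall (J : {set 'I_n}) (A : 'I_n -> set T),
    (forall i, measurable (A i)) ->
    P (\bigcap_(i in [set` J]) (X i @^-1` A i)) =
    (\prod_(i in J) P (X i @^-1` A i))%E.

Definition iid_with_density d d' (Omega : measurableType d)
    (T : measurableType d') (R : realType) (P : probability Omega R)
    (mu : {measure set T -> \bar R}) (p : T -> R) (n : nat)
    (X : 'I_n -> {RV P >-> T}) : Prop :=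
  mutually_independent X /\
  forall i A, measurable A -> distribution P (X i) A = density_law mu p A.

(* Main.v *)
Require Import Defs.
From HB Require Import structures.
From mathcomp Require Import all_boot all_order all_algebra.
From mathcomp Require Import all_classical all_reals all_analysis.
From mathcomp Require Import measurable_realfun.
From mathcomp Require Import ring lra.

Import Order.TTheory GRing.Theory Num.Theory.
Import numFieldNormedType.Exports.

Local Open Scope classical_set_scope.
Local Open Scope ring_scope.

(** The estimator is the mixture whose weights [theta] approximately maximise
    the log-likelihood plus the barrier [\sum_j ln (theta j)].

    Add a fresh point [X_(n+1)] and let [a] be the optimum for all [n + 1]
    points and [b_i] the optimum without the [i]-th one.  By exchangeability
    the risk is at most the average over [i] of
    [ln (p* X_i / p_(b_i) X_i) =
       ln (p* X_i / p_a X_i) + ln (p_a X_i / p_(b_i) X_i)].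
    First-order optimality of [a] tested against the weights of [p*] reads
    [\sum_i p* X_i / p_a X_i <= n + 1 + M], so the first terms sum to at most
    [M], without a logarithm.  Testing [a] against [b_i] and [b_i] against [a]
    and adding up shows that all ratios [b_i j / a j] lie in [[1/3, 3]] and that
    the second term is at most a constant times the leverage of the [i]-th row
    of the matrix [a j * p_j X_k / p_a X_k] regularised by the identity; the
    leverages sum to at most [M].  The constant obtained is [15]. *)

Set Implicit Arguments.
Unset Strict Implicit.
Unset Printing Implicit Defensive.

(** * Leverage scores *)

Section leverage.
Variables (R : realFieldType) (N M : nat) (G : 'M[R]_(N, M)).
Let H := G^T *m G + 1%:M.

Lemma gram1_form (y : 'cV[R]_M) :
  (y^T *m H *m y) 0 0 =
  \sum_k ((G *m y) k 0) ^+ 2 + \sum_j (y j 0) ^+ 2.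
Proof.
rewrite /H mulmxDr mulmxDl mulmx1 mxE; congr (_ + _).
  rewrite mulmxA -mulmxA -trmx_mul mxE.
  by apply: eq_bigr => k _; rewrite mxE expr2.
by rewrite mxE; apply: eq_bigr => j _; rewrite mxE expr2.
Qed.

Lemma gram1_form_ge0 (y : 'cV[R]_M) : 0 <= (y^T *m H *m y) 0 0.
Proof. by rewrite gram1_form addr_ge0// sumr_ge0// => *; exact: sqr_ge0. Qed.

Lemma gram1_sym : H^T = H.
Proof. by rewrite /H linearD/= trmx_mul trmxK trmx1. Qed.

(** The form dominates the squared Euclidean norm, so a kernel vector must vanish. *)
Lemma gram1_unit : H \in unitmx.
Proof.
rewrite -row_free_unit -kermx_eq0; apply/eqP/row_matrixP => i.
rewrite row0; set u := row i _.
have uH : u *m H = 0 by rewrite /u -row_mul mulmx_ker row0.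
have := gram1_form u^T; rewrite trmxK uH mul0mx mxE => /esym/eqP.
rewrite paddr_eq0; try by apply: sumr_ge0 => *; exact: sqr_ge0.
case/andP => _; rewrite psumr_eq0; last by move=> *; exact: sqr_ge0.
move=> /allP u0; apply/rowP => j.
have := u0 j (mem_index_enum _); rewrite /= sqrf_eq0 mxE [RHS]mxE.
by move/eqP.
Qed.

(* [h k] is the [k]-th diagonal entry of [G (G^T G + 1)^-1 G^T]. *)
Lemma leverage_scores : exists h : 'I_N -> R,
  [/\ forall k, 0 <= h k, \sum_k h k <= M%:R &
      forall i (y : 'cV[R]_M) (c : R), 2 * c * (G *m y) i 0 <=
        \sum_k ((G *m y) k 0) ^+ 2 + \sum_j (y j 0) ^+ 2 + c ^+ 2 * h i].
Proof.
have Hu := gram1_unit; have Hs := gram1_sym.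
set K := invmx H; have KH : K *m H = 1%:M by rewrite mulVmx.
have HK : H *m K = 1%:M by rewrite mulmxV.
have Ks : K^T = K by rewrite trmx_inv Hs.
have form_z p (B : 'M[R]_(M, p)) j :
    (B^T *m K *m B) j j = ((K *m col j B)^T *m H *m (K *m col j B)) 0 0.
  rewrite trmx_mul Ks -!mulmxA (mulmxA H) HK mul1mx !mulmxA tr_col.
  by rewrite -row_mul -row_mul colE mulmxA -colE !mxE.
have h0 i : 0 <= (G *m K *m G^T) i i.
  have := form_z _ G^T i; rewrite trmxK => ->; exact: gram1_form_ge0.
exists (fun i => (G *m K *m G^T) i i); split => //.
  (* The trace of [G K G^T] is that of [K (H - 1)], namely [M] minus the trace of [K], and the
     diagonal of [K] is nonnegative. *)
  rewrite -[X in X <= _]/(\tr _) -mulmxA mxtrace_mulC -mulmxA.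
  have -> : G^T *m G = H - 1%:M by rewrite /H addrK.
  rewrite mulmxBr KH mulmx1 linearB/= mxtrace1 lerBlDr lerDl.
  apply: sumr_ge0 => j _.
  have := form_z _ 1%:M j; rewrite trmx1 mul1mx mulmx1 => ->.
  exact: gram1_form_ge0.
move=> i y c.
(* The claim is nonnegativity of the form [H] at [y - c z], where [z] solves [H z = g] for the
   [i]-th row [g] of [G]. *)
set z := K *m (row i G)^T.
have hE : (G *m K *m G^T) i i = (z^T *m H *m z) 0 0.
  by have := form_z _ G^T i; rewrite trmxK -tr_row.
have Hz : H *m z = (row i G)^T by rewrite /z mulmxA HK mul1mx.
have zH : z^T *m H = row i G by rewrite -Hs -trmx_mul Hz trmxK.
have Gy : (row i G *m y) 0 0 = (G *m y) i 0 by rewrite -row_mul mxE.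
have yG : (y^T *m (row i G)^T) 0 0 = (G *m y) i 0.
  by rewrite -trmx_mul mxE Gy.
have := gram1_form_ge0 (y - c *: z).
have -> : (y - c *: z)^T = y^T - c *: z^T by rewrite linearB linearZ.
rewrite mulmxBl -scalemxAl mulmxBl !mulmxBr -!scalemxAr -!scalemxAl.
have entryB (A B : 'M[R]_1) : (A - B) 0 0 = A 0 0 - B 0 0 by rewrite !mxE.
have entryZ a (A : 'M[R]_1) : (a *: A) 0 0 = a * A 0 0 by rewrite !mxE.
rewrite !(entryB, entryZ) -hE gram1_form -(mulmxA y^T) Hz yG zH Gy => ?; lra.
Qed.
End leverage.

Lemma ln_leB1 (R : realType) (x : R) : 0 < x -> ln x <= x - 1.
Proof. by move=> x0; rewrite -{1}(subrKC 1 x) le_ln1Dx// ltrBrDl subrr. Qed.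

(** * The barrier likelihood and its EM iteration *)

Section interior_simplex.
Variables (R : realType) (M : nat).

Definition mix (c v : 'I_M -> R) : R := \sum_j c j * v j.

Definition simplex (c : 'I_M -> R) : Prop :=
  (forall j, 0 <= c j) /\ \sum_j c j = 1.

Definition open_simplex (c : 'I_M -> R) : Prop :=
  (forall j, 0 < c j) /\ \sum_j c j = 1.

Lemma open_simplexW c : open_simplex c -> simplex c.
Proof. by move=> [c0 c1]; split=> // j; exact: ltW. Qed.

Lemma mix_ge0 c v :
  (forall j, 0 <= c j) -> (forall j, 0 <= v j) -> 0 <= mix c v.
Proof. by move=> c0 v0; apply: sumr_ge0 => j _; exact: mulr_ge0. Qed.

Lemma mix_gt0 c v : (forall j, 0 < c j) -> (forall j, 0 <= v j) ->
  0 < \sum_j v j -> 0 < mix c v.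
Proof.
move=> c0 v0 vs.
have [j vj] : exists j, v j != 0.
  apply/existsP; rewrite -negb_forall; apply: contraL vs => /forallP v00.
  by rewrite big1 ?ltxx// => j _; exact/eqP.
rewrite /mix (bigD1 j)//= ltr_pwDl//.
  by rewrite mulr_gt0// lt_neqAle eq_sym vj v0.
by apply: sumr_ge0 => i _; rewrite mulr_ge0// ltW.
Qed.

Lemma sum_mix_div N (c : 'I_M -> R) (f : 'I_N -> 'I_M -> R) (w : 'I_N -> R) :
  \sum_j c j * (\sum_k f k j / w k) = \sum_k mix c (f k) / w k.
Proof.
under eq_bigr do rewrite mulr_sumr.
rewrite exchange_big/=; apply: eq_bigr => k _.
by rewrite /mix mulr_suml; apply: eq_bigr => j _; rewrite mulrA.
Qed.

(** Averaging the tangent bound [ln x <= x - 1] at [x = r j / mix w r] makes its right side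
    vanish. *)
Lemma jensen_ln (w r : 'I_M -> R) : simplex w -> (forall j, 0 < r j) ->
  \sum_j w j * ln (r j) <= ln (mix w r).
Proof.
move=> [w0 w1] r0.
have s0 : 0 < mix w r.
  have /lt0r_neq0 : 0 < \sum_j w j by rewrite w1.
  move=> ws; have [j wj] : exists j, w j != 0.
    apply/existsP; rewrite -negb_forall; apply: contra ws => /forallP w00.
    by rewrite big1// => j _; exact/eqP.
  rewrite /mix (bigD1 j)//= ltr_pwDl//.
    by rewrite mulr_gt0// lt_neqAle eq_sym wj w0.
  by apply: sumr_ge0 => i _; rewrite mulr_ge0// ltW.
rewrite -subr_le0 -[X in _ - X]mul1r -w1 mulr_suml -sumrB.
apply: (@le_trans _ _ (\sum_j w j * (r j / mix w r - 1))).
  apply: ler_sum => j _; rewrite -mulrBr ler_wpM2l// -ln_div ?posrE//.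
  by rewrite ln_leB1// divr_gt0.
under eq_bigr do rewrite mulrBr mulr1 mulrA.
by rewrite sumrB w1 -mulr_suml divff ?gt_eqF// subrr.
Qed.

End interior_simplex.

Section barrier.
Variables (R : realType) (N M : nat).
Hypothesis M0 : (0 < M)%N.
Implicit Types (P : 'I_N -> 'I_M -> R) (a b c : 'I_M -> R) (e : R).

Definition positive_rows P : Prop :=
  (forall k j, 0 <= P k j) /\ (forall k, 0 < \sum_j P k j).

(* Partial derivatives of [potential] below; at its maximiser over the simplex
   they all equal the Lagrange multiplier [N + M]. *)
Definition score P a (j : 'I_M) : R := \sum_k P k j / mix a (P k) + (a j)^-1.

(** Approximate first-order optimality: testing [a] against any simplex point averages these
    finitely many inequalities. *)
Definition near_opt e P a : bool := [forall j, score P a j <= N%:R + M%:R + e].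

(** The EM update under the barrier: expected component counts, each increased by one, divided by
    their total. *)
Definition em P a (j : 'I_M) : R := a j * score P a j / (N%:R + M%:R).

(** Near-optimal points stay fixed, so an iterate that is not near-optimal certifies that no earlier
    one was. *)
Definition em_step e P a : 'I_M -> R := if near_opt e P a then a else em P a.

(* Running a number of steps that does not depend on [P] keeps the result
   measurable in [P], with no selection of a maximiser. *)
Definition em_iter e P (K : nat) : 'I_M -> R :=
  iter K (em_step e P) (fun=> M%:R^-1).

Definition potential P a : R := \sum_k ln (mix a (P k)) + \sum_j ln (a j).

Let L : R := N%:R + M%:R.

Let L0 : 0 < L.
Proof. by rewrite ltr_wpDl// ltr0n. Qed.

Variable P : 'I_N -> 'I_M -> R.
Hypothesis hP : positive_rows P.

Let P_ge0 k j : 0 <= P k j. Proof. by case: hP. Qed.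

Lemma mix_row_gt0 a k : open_simplex a -> 0 < mix a (P k).
Proof. by move=> [a0 _]; case: hP => P0 P1; exact: mix_gt0. Qed.

Lemma score_mix a c : open_simplex a ->
  \sum_j c j * score P a j =
  \sum_k mix c (P k) / mix a (P k) + \sum_j c j / a j.
Proof.
move=> ha; under eq_bigr do rewrite mulrDr.
by rewrite big_split/= sum_mix_div.
Qed.

Lemma near_optP e a c : open_simplex a -> near_opt e P a -> simplex c ->
  \sum_k mix c (P k) / mix a (P k) + \sum_j c j / a j <= L + e.
Proof.
move=> ha /forallP na [c0 c1]; rewrite -score_mix//.
rewrite -[leRHS]mul1r -c1 mulr_suml; apply: ler_sum => j _.
by rewrite ler_wpM2l.
Qed.

Lemma score_self a : open_simplex a -> \sum_j a j * score P a j = L.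
Proof.
move=> ha; rewrite score_mix// (eq_bigr (fun=> 1)); last first.
  by move=> k _; rewrite divff// gt_eqF// mix_row_gt0.
rewrite [X in _ + X](eq_bigr (fun=> 1)); last first.
  by move=> j _; rewrite divff// gt_eqF//; case: ha.
by rewrite !sumr_const !card_ord.
Qed.

Lemma score_ge a j : open_simplex a -> (a j)^-1 <= score P a j.
Proof.
move=> ha; rewrite lerDr; apply: sumr_ge0 => k _.
by rewrite divr_ge0// ltW// mix_row_gt0.
Qed.

Lemma em_ge a j : open_simplex a -> L^-1 <= em P a j.
Proof.
move=> ha; rewrite -[leLHS]mul1r ler_pM2r ?invr_gt0//.
rewrite -(@divff _ (a j)) ?gt_eqF//; last by case: ha.
by rewrite ler_pM2l ?score_ge//; case: ha.
Qed.

Lemma em_open a : open_simplex a -> open_simplex (em P a).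
Proof.
move=> ha; split=> [j|].
  by rewrite (lt_le_trans _ (em_ge j ha)) ?invr_gt0.
by rewrite -mulr_suml score_self// divff ?gt_eqF.
Qed.

(** EM ascent: Jensen with the posterior weights [a j * P k j / mix a (P k)] bounds the increase of
    each [ln (mix _ (P k))] from below. Summed over [k], plus one for the barrier, these weights
    give [L * em P a j]. *)
Lemma potential_em a : open_simplex a ->
  L * \sum_j em P a j * ln (em P a j / a j) <=
  potential P (em P a) - potential P a.
Proof.
move=> ha; have hb := em_open ha; set b := em P a in hb *.
have a0 j : 0 < a j by case: ha.
have b0 j : 0 < b j by case: hb.
have r0 j : 0 < b j / a j by rewrite divr_gt0.
have bE j : L * b j = \sum_k (a j * P k j / mix a (P k)) + 1.
  rewrite /b /em mulrCA divff ?gt_eqF// mulr1 /score mulrDr divff ?gt_eqF//.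
  by rewrite mulr_sumr; under eq_bigr do rewrite mulrA.
rewrite mulr_sumr (eq_bigr (fun j => \sum_k (a j * P k j / mix a (P k)) *
  ln (b j / a j) + ln (b j / a j))); last first.
  by move=> j _; rewrite mulrA bE mulrDl mul1r mulr_suml.
rewrite big_split/= exchange_big/= /potential opprD addrACA -!sumrB.
apply: lerD; last first.
  by apply: ler_sum => j _; rewrite ln_div ?posrE.
apply: ler_sum => k _; rewrite -ln_div ?posrE ?mix_row_gt0//.
apply: le_trans (jensen_ln _ r0) _.
  split=> [j|].
    by rewrite divr_ge0 ?(ltW (mix_row_gt0 _ _))// mulr_ge0// ltW.
  by rewrite -mulr_suml divff ?gt_eqF// mix_row_gt0.
rewrite le_eqVlt; apply/orP; left; apply/eqP; congr ln.
rewrite /mix mulr_suml; apply: eq_bigr => j _.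
by field; rewrite !gt_eqF// mix_row_gt0.
Qed.

(* Lower bound for the increase of [potential] in one [em] step started at a
   point that is not [near_opt]. *)
Definition gain e : R := ln (1 + e / L) - (e / L) / (1 + e / L).

Lemma gain_gt0 e : 0 < e -> 0 < gain e.
Proof.
move=> e0; rewrite /gain; set x := e / L.
have x0 : 0 < x by rewrite divr_gt0.
have x1 : 0 < 1 + x by rewrite addr_gt0.
have s0 : 0 < Num.sqrt (1 + x)^-1 by rewrite sqrtr_gt0 invr_gt0.
have sE : (Num.sqrt (1 + x)^-1) ^+ 2 = (1 + x)^-1.
  by rewrite sqr_sqrtr// invr_ge0 ltW.
have s1 : Num.sqrt (1 + x)^-1 != 1.
  apply/eqP => s1; move: sE; rewrite s1 expr1n => /esym/eqP.
  by rewrite invr_eq1 => /eqP; lra.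
(* The tangent bound for [ln] is not strict; applied to the square root [s] it leaves the positive
   slack [(s - 1) ^+ 2]. *)
have -> : ln (1 + x) = - (ln (Num.sqrt (1 + x)^-1) *+ 2).
  by rewrite -lnXn// sE lnV ?posrE// opprK.
have -> : x / (1 + x) = 1 - (1 + x)^-1 by field; rewrite gt_eqF.
rewrite -{2}sE; set s := Num.sqrt _ in s0 s1 *.
have := ln_leB1 s0.
have : 0 < (s - 1) ^+ 2.
  by rewrite lt_neqAle sqr_ge0 andbT eq_sym sqrf_eq0 subr_eq0.
by rewrite mulr2n; nra.
Qed.

Lemma em_gain e a : 0 < e -> open_simplex a -> ~~ near_opt e P a ->
  potential P a + gain e <= potential P (em P a).
Proof.
move=> e0 ha; rewrite negb_forall => /existsP[i]; rewrite -ltNge => si.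
rewrite addrC -lerBrDr; apply: le_trans (potential_em ha).
have hb := em_open ha; have bi := em_ge i ha.
have rE j : em P a j / a j = score P a j / L.
  by rewrite /em -/L; field; rewrite !gt_eqF//; case: ha.
set b := em P a in hb bi rE *.
have a0 j : 0 < a j by case: ha.
have b0 j : 0 < b j by case: hb.
have r0 j : 0 < b j / a j by rewrite divr_gt0.
(* Both points have mass one, so adding [a j - b j] preserves the sum and makes every term
   nonnegative; only the term at [i] is then kept. *)
have tE : \sum_j b j * ln (b j / a j) =
    \sum_j b j * (ln (b j / a j) - 1 + a j / b j).
  under [RHS]eq_bigr do rewrite mulrDr mulrBr mulr1.
  rewrite big_split/= sumrB.
  rewrite [X in _ = _ + X](eq_bigr a).
    by case: ha => _ ->; case: hb => _ ->; rewrite subrK.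
  by move=> j _; rewrite mulrC divfK ?gt_eqF.
rewrite tE (bigD1 i)//= mulrDr ler_wpDr//.
  apply: mulr_ge0; first exact: ltW.
  apply: sumr_ge0 => j _; apply: mulr_ge0; first exact: ltW.
  have := ln_leB1 (divr_gt0 (a0 j) (b0 j)).
  rewrite -[in ln _]invf_div lnV ?posrE//; lra.
have rr : 1 + e / L < b i / a i.
  by rewrite rE ltr_pdivlMr// mulrDl mul1r divfK ?gt_eqF.
have q0 : 0 < 1 + e / L by rewrite addr_gt0// divr_gt0.
(* [gain e] is the value of the increasing function [ln x - 1 + x^-1] at [x = 1 + e / L]. *)
have gr : gain e <= ln (b i / a i) - 1 + a i / b i.
  have := ln_leB1 (divr_gt0 q0 (r0 i)).
  rewrite (@ln_div _ (1 + e / L)) ?posrE// /gain -(invf_div (b i)) => h.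
  have : e / L / (b i / a i) <= e / L / (1 + e / L).
    by rewrite ler_pM2l ?divr_gt0// lef_pV2 ?posrE// ltW.
  by move: h; rewrite [X in _ <= X - _]mulrDl mul1r; lra.
(* The factor [L * b i] is at least one by [em_ge]. *)
apply: (le_trans gr); rewrite mulrA ler_peMl//.
  exact: le_trans (ltW (gain_gt0 e0)) gr.
by rewrite -(@divff _ L) ?gt_eqF// ler_pM2l.
Qed.

Lemma unif_open : open_simplex (fun _ : 'I_M => M%:R^-1 : R).
Proof.
split=> [j|]; first by rewrite invr_gt0 ltr0n.
by rewrite sumr_const card_ord -[LHS]mulr_natl divff// pnatr_eq0 -lt0n.
Qed.

Lemma em_iter_open e K : open_simplex (em_iter e P K).
Proof.
elim: K => [|K IH]; first exact: unif_open.
by rewrite /em_iter iterS /em_step; case: ifP => // _; exact: em_open.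
Qed.

Lemma open_simplex_le1 a j : open_simplex a -> a j <= 1.
Proof.
move=> [a0 <-]; rewrite (bigD1 j)//= lerDl; apply: sumr_ge0 => i _.
exact: ltW.
Qed.

(** Since [a j <= 1], each of the [N + M] logarithms exceeds its value at the uniform weights by at
    most [ln M]. *)
Lemma potential_le_unif a : open_simplex a ->
  potential P a <= potential P (fun=> M%:R^-1) + L * ln M%:R.
Proof.
move=> ha; rewrite /potential mulrDl addrACA.
have MR : 0 < M%:R :> R by rewrite ltr0n.
have constE K : K%:R * ln M%:R = \sum_(k < K) ln (M%:R : R).
  by rewrite sumr_const card_ord mulr_natl.
rewrite 2!constE -!big_split/=; apply: lerD; apply: ler_sum => k _.
- rewrite -lnM ?posrE ?mix_row_gt0//; last exact: unif_open.
  rewrite ler_ln ?posrE ?mulr_gt0 ?mix_row_gt0//; last exact: unif_open.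
  rewrite /mix mulr_suml; apply: ler_sum => j _.
  rewrite mulrAC mulVf ?gt_eqF// mul1r ler_piMl//.
  exact: open_simplex_le1.
- rewrite -lnM ?posrE ?invr_gt0// mulVf ?gt_eqF//.
  by rewrite ler_ln ?posrE// ?open_simplex_le1//; case: ha.
Qed.

Lemma em_iter_gain e K : 0 < e -> ~~ near_opt e P (em_iter e P K) ->
  potential P (fun=> M%:R^-1) + K%:R * gain e <= potential P (em_iter e P K).
Proof.
move=> e0; elim: K => [|K IH]; first by rewrite mul0r addr0.
rewrite /em_iter iterS -/(em_iter e P K) /em_step; case: ifPn => [->//|nK _].
rewrite -natr1 mulrDl mul1r addrA.
apply: le_trans (em_gain e0 (em_iter_open e K) nK).
by rewrite lerD2r IH.
Qed.

(** Otherwise each of the [K] steps raised the potential by at least [gain e], in total more than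
    the room above the uniform start. *)
Lemma em_iter_near_opt e K : 0 < e -> L * ln M%:R < K%:R * gain e ->
  near_opt e P (em_iter e P K).
Proof.
move=> e0 hK; apply/negPn/negP => nK.
have := le_trans (em_iter_gain e0 nK) (potential_le_unif (em_iter_open e K)).
by rewrite lerD2l leNgt hK.
Qed.

End barrier.

(** * Leave-one-out stability *)

Section symmetrised_ratio.
Variable R : realFieldType.
Implicit Type x : R.

Lemma ratio_gap_ge0 x : 0 < x -> 0 <= x + x^-1 - 2.
Proof.
move=> x0; have -> : x + x^-1 - 2 = (x - 1) ^+ 2 / x by field; rewrite gt_eqF.
by rewrite divr_ge0 ?sqr_ge0// ltW.
Qed.

(** The value [4 / 3] is attained exactly at [1 / 3] and [3]. *)
Lemma ratio_gap_le x : 0 < x -> x + x^-1 - 2 <= 4 / 3 -> 1 / 3 <= x <= 3.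
Proof.
move=> x0 h.
have : (x + x^-1 - 2) * x <= 4 / 3 * x by rewrite ler_pM2r.
have -> : (x + x^-1 - 2) * x = (x - 1) ^+ 2 by field; rewrite gt_eqF.
by move=> h1; apply/andP; split; nra.
Qed.

Lemma ratio_gap_sqr x : 0 < x -> x <= 3 -> (x - 1) ^+ 2 <= 3 * (x + x^-1 - 2).
Proof.
move=> x0 x3; rewrite (_ : x + x^-1 - 2 = (x - 1) ^+ 2 / x); last first.
  by field; rewrite gt_eqF.
rewrite mulrA ler_pdivlMr// [leLHS]mulrC ler_wpM2r ?sqr_ge0//.
Qed.

End symmetrised_ratio.

Section leave_one_out.
Variables (R : realType) (N M : nat).
Hypothesis M0 : (0 < M)%N.
Variable P : 'I_N.+1 -> 'I_M -> R.
Hypothesis hP : positive_rows P.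

Let hPl i : positive_rows (fun k => P (lift i k)).
Proof. by case: hP. Qed.

Definition weights (a : 'I_M -> R) : 'M[R]_(N.+1, M) :=
  \matrix_(k, j) (a j * P k j / mix a (P k)).

Lemma ln_ratio_le_leverage (i : 'I_N.+1) (a b : 'I_M -> R) (e h : R) :
  0 <= e -> e <= 6^-1 -> 0 <= h ->
  open_simplex a -> near_opt e P a ->
  open_simplex b -> near_opt e (fun k => P (lift i k)) b ->
  (forall (y : 'cV[R]_M) (c : R), 2 * c * (weights a *m y) i 0 <=
     \sum_k ((weights a *m y) k 0) ^+ 2 + \sum_j (y j 0) ^+ 2 + c ^+ 2 * h) ->
  ln (mix a (P i) / mix b (P i)) <= 12 * h + 8 * e.
Proof.
move=> e0 e6 h0 ha na hb nb hlev.
have P0 k j : 0 <= P k j by case: hP.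
have a0 j : 0 < a j by case: ha.
have b0 j : 0 < b j by case: hb.
have ma k : 0 < mix a (P k) by exact: mix_row_gt0.
have mb k : 0 < mix b (P k) by exact: mix_row_gt0.
pose u k := mix b (P k) / mix a (P k); pose v j := b j / a j.
have u0 k : 0 < u k by rewrite divr_gt0.
have v0 j : 0 < v j by rewrite divr_gt0.
(* [F1] tests [a] against [b]; [F2] tests [b], which ignores row [i], against [a]. Their sum bounds
   all gaps at once in [S]. *)
have F1 := near_optP ha na (open_simplexW hb).
have F2 := near_optP hb nb (open_simplexW ha).
have {}F2 : \sum_k (u (lift i k))^-1 + \sum_j (v j)^-1 <= N%:R + M%:R + e.
  apply: le_trans F2; rewrite le_eqVlt; apply/orP; left; apply/eqP.
  by congr (_ + _); apply: eq_bigr => k _; rewrite invf_div.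
have {}F1 : u i + \sum_k u (lift i k) + \sum_j v j <= N%:R + 1 + M%:R + e.
  by move: F1; rewrite (bigD1_ord i)//= -natr1.
pose gap (x : R) := x + x^-1 - 2.
have S : \sum_k gap (u (lift i k)) + \sum_j gap (v j) <= 1 - u i + 2 * e.
  rewrite /gap !sumrB !big_split/= !sumr_const !card_ord.
  lra.
have gu0 k : 0 <= gap (u k) by exact: ratio_gap_ge0.
have gv0 j : 0 <= gap (v j) by exact: ratio_gap_ge0.
have Su0 : 0 <= \sum_k gap (u (lift i k)) by apply: sumr_ge0.
have Sv0 : 0 <= \sum_j gap (v j) by apply: sumr_ge0.
(* As [u i > 0] and [e <= 1 / 6], the total gap is at most [4 / 3]. *)
have vb j : 1 / 3 <= v j <= 3.
  apply: ratio_gap_le => //.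
  have : gap (v j) <= \sum_j gap (v j).
    by rewrite [leRHS](bigD1 j)//= lerDl; apply: sumr_ge0.
  have := u0 i; rewrite /gap; lra.
(* Each [u k], including the left-out [k = i], is the average of the [v j] with row [k] of
   [weights a]. *)
have ub k : 1 / 3 <= u k <= 3.
  rewrite ler_pdivlMr// ler_pdivrMr// /mix !mulr_sumr; apply/andP; split;
    apply: ler_sum => j _; rewrite mulrA ler_wpM2r//;
    have /andP[] := vb j; rewrite ler_pdivlMr// ler_pdivrMr//.
set d := 1 - u i.
have dlo : - (2 * e) <= d by rewrite /d; lra.
have dhi : d <= 2 / 3 by rewrite /d; have /andP[] := ub i; lra.
(* [Q] bounds the squared norm of [b - a] for the form [G^T G + 1], in the
   coordinates [v j - 1]; by Cauchy-Schwarz this controls [d]. *)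
have Q : \sum_k (u k - 1) ^+ 2 + \sum_j (v j - 1) ^+ 2 <=
    d ^+ 2 + 3 * (d + 2 * e).
  rewrite (bigD1_ord i)//= -[in leLHS]sqrrN opprB -/d -addrA lerD2l.
  apply: (@le_trans _ _ (3 * (\sum_k gap (u (lift i k)) + \sum_j gap (v j)))).
    rewrite mulrDr !mulr_sumr; apply: lerD; apply: ler_sum => k _.
      by apply: ratio_gap_sqr => //; have /andP[] := ub (lift i k).
    by apply: ratio_gap_sqr => //; have /andP[] := vb k.
  by rewrite ler_pM2l// /d.
pose y : 'cV[R]_M := \col_j (v j - 1).
have Gy k : (weights a *m y) k 0 = u k - 1.
  rewrite mxE (eq_bigr (fun j => (b j * P k j - a j * P k j) / mix a (P k))).
    by rewrite -mulr_suml sumrB -/(mix b (P k)) -/(mix a (P k)) mulrBl divff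
               ?gt_eqF.
  by move=> j _; rewrite !mxE /v; field; rewrite !gt_eqF.
(* With [c = -4] the left side is [8 d] and the leverage term [16 h]; by [Q] and [dd] the squared
   norm costs at most [4 d + 10 e]. *)
have := hlev y (-4); rewrite Gy.
under eq_bigr do rewrite Gy.
under [X in _ + X + _]eq_bigr do rewrite mxE.
move=> hl.
have dd : d ^+ 2 <= d + 4 * e by nra.
have dh : d <= 4 * h + 5 / 2 * e.
  have {}hl : 8 * d <= \sum_k (u k - 1) ^+ 2 + \sum_j (v j - 1) ^+ 2 + 16 * h.
    by move: hl; rewrite /d; lra.
  lra.
rewrite -invf_div -/(u i).
have ui3 : 0 < (u i)^-1 <= 3.
  rewrite invr_gt0 u0/= -[leRHS]invrK lef_pV2 ?posrE// ?invr_gt0//.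
  by have /andP[] := ub i; rewrite mul1r.
apply: (le_trans (ln_leB1 _)); first by rewrite invr_gt0.
have -> : (u i)^-1 - 1 = d * (u i)^-1.
  by rewrite /d mulrBl mul1r divff ?gt_eqF.
by case/andP: ui3 => ? ?; nra.
Qed.

(* [1 + max (ln r, -1)], with no junk value at [r = 0]; unlike [ln r] it is
   bounded below, so that Tonelli applies. *)
Definition lnp (r : R) : R := ln (Num.max (expR 1 * r) 1).

Lemma lnp_ge0 r : 0 <= lnp r.
Proof. by rewrite ln_ge0// le_max lexx orbT. Qed.

Lemma lnp_ge r : 0 < r -> 1 + ln r <= lnp r.
Proof.
move=> r0; rewrite -[X in X + _]expRK -lnM ?posrE ?expR_gt0//.
by rewrite ler_ln ?posrE ?mulr_gt0 ?expR_gt0 ?lt_max ?ltr01 ?orbT// le_max lexx.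
Qed.

Lemma lnp_le r s : 0 <= s -> (0 < r -> 1 + ln r <= s) -> lnp r <= s.
Proof.
move=> s0 hs; rewrite /lnp; case: (leP (expR 1 * r) 1) => [_|h].
  by rewrite ln1.
have r0 : 0 < r by rewrite -(pmulr_rgt0 _ (expR_gt0 1)) (lt_trans _ h).
by rewrite lnM ?posrE ?expR_gt0// expRK hs.
Qed.

(** The [15] collects [M] from first-order optimality, [12 M] from the leverages and [2 M] absorbing
    the errors [e] and [8 (N + 1) e <= 1]. *)
Theorem leave_one_out (b : 'I_N.+1 -> 'I_M -> R) (c : 'I_M -> R) (e : R) :
  0 < e -> e <= 6^-1 -> 8 * N.+1%:R * e <= 1 ->
  (forall i, open_simplex (b i)) ->
  (forall i, near_opt e (fun k => P (lift i k)) (b i)) ->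
  simplex c ->
  \sum_i lnp (mix c (P i) / mix (b i) (P i)) <= N.+1%:R + 15 * M%:R.
Proof.
move=> e0 e6 eN hb nb hc.
have [K hK] : exists K : nat, (N.+1%:R + M%:R) * ln M%:R < K%:R * gain N.+1 M e.
  have g0 : 0 < gain N.+1 M e by exact: gain_gt0.
  exists (Num.bound ((N.+1%:R + M%:R) * ln M%:R / gain N.+1 M e)).
  rewrite -ltr_pdivrMr// archi_boundP// divr_ge0 ?mulr_ge0 ?ln_ge0//.
  - by rewrite ler1n.
  - exact: ltW.
(* The full-sample optimum is replaced by the iteration run on all [N + 1] rows. *)
set a := em_iter e P K.
have ha : open_simplex a by exact: em_iter_open.
have na : near_opt e P a by exact: em_iter_near_opt.
have [h [h0 hM hlev]] := leverage_scores (weights a).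
have c0 j : 0 <= c j by case: hc.
have ma k : 0 < mix a (P k) by exact: mix_row_gt0.
have mb i : 0 < mix (b i) (P i) by exact: mix_row_gt0.
have mc i : 0 <= mix c (P i) by apply: mix_ge0 => // j; case: hP.
apply: (@le_trans _ _
    (\sum_i (mix c (P i) / mix a (P i) + (12 * h i + 8 * e)))).
  apply: ler_sum => i _; apply: lnp_le.
    by rewrite addr_ge0 ?divr_ge0 ?mc ?ltW// ltr_wpDl// ?mulr_gt0// mulr_ge0.
  move=> r0.
  have mci : 0 < mix c (P i) by move: r0; rewrite pmulr_lgt0 ?invr_gt0.
  have := ln_ratio_le_leverage (ltW e0) e6 (h0 i) ha na (hb i) (nb i) (hlev i).
  have := ln_leB1 (divr_gt0 mci (ma i)).
  rewrite !ln_div ?posrE//; lra.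
rewrite !big_split/= -mulr_sumr sumr_const card_ord -[_ *+ N.+1]mulr_natl.
have := near_optP ha na hc.
have : 0 <= \sum_j c j / a j.
  by apply: sumr_ge0 => j _; rewrite divr_ge0// ltW//; case: ha.
have : 1 <= M%:R :> R by rewrite ler1n.
lra.
Qed.

End leave_one_out.

(** * Measurability and integration preliminaries *)

Lemma measurable_invr (R : realType) : measurable_fun [set: R] (@GRing.inv R).
Proof.
(* At [0] the outer factor yields the default value [0] of the inverse, whatever [ln 0] is. *)
rewrite (_ : GRing.inv = fun x : R => x * expR (- ln (x ^+ 2))).
  have m2 : measurable_fun [set: R] (fun x : R => x ^+ 2).
    exact: measurable_funX.
  apply: measurable_funM; first exact: measurable_id.
  apply: (measurableT_comp (@measurable_expR R)).
  by apply: measurable_funN; exact: measurableT_comp.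
apply/funext => x; have [->|x0] := eqVneq x 0; first by rewrite invr0 mul0r.
have x2 : 0 < x ^+ 2 by rewrite lt_neqAle eq_sym sqrf_eq0 x0 sqr_ge0.
by rewrite expRN lnK ?posrE// expr2 invfM mulrA divff// mul1r.
Qed.

Section integral_wo_measurability.
Local Open Scope ereal_scope.
Context d (T : measurableType d) (R : realType).
Variable mu : {measure set T -> \bar R}.

(** The integral is a difference of suprema over simple functions below the positive and negative
    parts, each monotone. It bounds the expected KL loss directly. *)
Lemma le_integral_pointwise (f g : T -> \bar R) : (forall x, f x <= g x) ->
  \int[mu]_x f x <= \int[mu]_x g x.
Proof.
move=> fg; rewrite /integral !patch_setT; apply: leeB.
  apply: le_ereal_sup => _ [h hf <-]; exists h => // x.
  apply: le_trans (hf x) _.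
  by apply: (@funepos_le _ _ setT) => [t _|]; rewrite ?inE.
apply: le_ereal_sup => _ [h hf <-]; exists h => // x.
apply: le_trans (hf x) _.
  by apply: (@funeneg_le _ _ setT) => [t _|]; rewrite ?inE.
Qed.

End integral_wo_measurability.

Section density_law.
Import HBNNSimple.
Local Open Scope ereal_scope.
Context d (T : measurableType d) (R : realType).
Variables (mu nu : {measure set T -> \bar R}) (p : T -> R).
Hypothesis mp : measurable_fun [set: T] p.
Hypothesis p0 : forall x, (0 <= p x)%R.
Hypothesis nuE : forall A, measurable A -> nu A = density_law mu p A.

(** On indicators this is [nuE]; simple approximations and monotone convergence on both sides give
    the rest. *)
Lemma ge0_integral_density_law (f : T -> R) : measurable_fun [set: T] f ->
  (forall x, (0 <= f x)%R) ->
  \int[nu]_x (f x)%:E = \int[mu]_x (f x * p x)%:E.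
Proof.
move=> mf f0.
have mEf : measurable_fun [set: T] (EFin \o f) by exact/measurable_EFinP.
pose h := nnsfun_approx measurableT mEf.
have hcvg x : (EFin \o h n) x @[n --> \oo] --> (f x)%:E.
  by apply: cvg_nnsfun_approx => // t _; rewrite lee_fin.
have -> : \int[nu]_x (f x)%:E = limn (fun n => \int[nu]_x (h n x)%:E).
  under eq_integral => x _ do rewrite -(cvg_lim _ (hcvg x))//.
  apply: monotone_convergence => //.
  - by move=> n; apply/measurable_EFinP.
  - by move=> n x _; rewrite lee_fin.
  - by move=> x _ a b ab; rewrite lee_fin; exact/lefP/nd_nnsfun_approx.
have -> : \int[mu]_x (f x * p x)%:E =
    limn (fun n => \int[mu]_x (h n x * p x)%:E).
  have hpcvg x : (h n x * p x)%:E @[n --> \oo] --> (f x * p x)%:E.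
    under eq_fun do rewrite EFinM.
    rewrite EFinM; apply: cvgeZr; [by []|exact: hcvg].
  under eq_integral => x _ do rewrite -(cvg_lim _ (hpcvg x))//.
  apply: monotone_convergence => //.
  - move=> n; apply/measurable_EFinP; apply: measurable_funM => //.
  - by move=> n x _; rewrite lee_fin mulr_ge0.
  - move=> x _ a b ab; rewrite lee_fin ler_wpM2r//.
    exact/lefP/nd_nnsfun_approx.
congr (limn _); apply/funext => n.
have hE x : h n x = (\sum_(y \in range (h n)) y * \1_(h n @^-1` [set y]) x)%R.
  by rewrite {1}fimfunE.
under eq_integral do rewrite hE -fsumEFin//.
under [RHS]eq_integral do rewrite hE EFinM -fsumEFin//.
have y0 y x : (0 <= y * \1_(h n @^-1` [set y]) x)%R.
  by have := nnfun_muleindic_ge0 (h n) y x; rewrite -EFinM lee_fin.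
have mA y : measurable (h n @^-1` [set y]) by [].
have mind y :
    measurable_fun [set: T] (fun x => (y * \1_(h n @^-1` [set y]) x)%R).
  by apply: measurable_funM => //; exact: measurable_indic.
rewrite ge0_integral_fsum//; last 2 first.
  by move=> y; exact/measurable_EFinP.
  by move=> y x _; rewrite lee_fin.
under [RHS]eq_integral => x _.
  rewrite ge0_mule_fsuml; last by move=> y; rewrite lee_fin.
  over.
rewrite /=.
rewrite ge0_integral_fsum//; last 2 first.
  move=> y; under eq_fun do rewrite -EFinM.
  by apply/measurable_EFinP; exact: measurable_funM.
  by move=> y x _; rewrite mule_ge0 ?lee_fin.
apply: eq_fsbigr => y; rewrite inE => -[t _ <-].
set A := h n @^-1` _; set r := h n t.
have r0 : (0 <= r)%R by [].
under eq_integral do rewrite EFinM.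
under [RHS]eq_integral do rewrite EFinM -muleA.
rewrite !ge0_integralZl_EFin//; last 3 first.
- by move=> x _; rewrite mule_ge0 ?lee_fin.
- under eq_fun do rewrite -EFinM.
  apply/measurable_EFinP; apply: measurable_funM => //.
  by apply: measurable_indic; exact: mA.
- by apply/measurable_EFinP; apply: measurable_indic; exact: mA.
have mAA : measurable A by exact: mA.
have -> : \int[nu]_x (\1_A x)%:E = nu A by rewrite integral_indic ?setIT.
rewrite nuE// /density_law; congr (_ * _).
rewrite integral_mkcond; apply: eq_integral => x _.
by rewrite epatch_indic /= muleC.
Qed.

End density_law.

(** * Exchangeability *)

Section tuple_pair.
Context d (T : measurableType d) (n : nat).
Implicit Types (A : 'I_n -> set T) (B : set T).

Definition rectangle A B : set (n.-tuple T * T) :=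
  [set z | (forall k, A k (tnth z.1 k)) /\ B z.2].

(** A pi-system generating the product sigma-algebra, on which laws are compared. *)
Definition rectangles : set (set (n.-tuple T * T)) :=
  [set C | exists A B, [/\ forall k, measurable (A k), measurable B &
    C = rectangle A B]].

Lemma measurable_rectangle A B : (forall k, measurable (A k)) ->
  measurable B -> measurable (rectangle A B).
Proof.
move=> mA mB.
rewrite (_ : rectangle A B = (\bigcap_(k in [set: 'I_n])
    ((fun z : n.-tuple T * T => tnth z.1 k) @^-1` A k)) `&` snd @^-1` B).
  apply: measurableI; last by rewrite -[_ @^-1` _]setTI; exact: measurable_snd.
  apply: fin_bigcap_measurable => // k _.
  rewrite -[_ @^-1` _]setTI.
  by apply: (measurableT_comp (measurable_tnth k) measurable_fst).
by apply/seteqP; split=> [z [zA zB]|z [zA zB]]; split=> // k; [move=> _|];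
  exact: zA.
Qed.

Lemma rectangleT : rectangle (fun=> setT) setT = setT.
Proof. by apply/seteqP; split. Qed.

Lemma measurable_rectangles :
  @measurable _ (n.-tuple T * T)%type = <<s rectangles >>.
Proof.
apply/seteqP; split; last first.
  apply: smallest_sub; first exact: sigma_algebra_measurable.
  by move=> _ [A [B [mA mB ->]]]; exact: measurable_rectangle.
move=> C mC.
have mid : measurable_fun [set: g_sigma_algebraType rectangles]
    (id : g_sigma_algebraType rectangles -> n.-tuple T * T).
  apply/measurable_fun_pairP; split.
    apply/measurable_fun_tnthP => k _ B mB; rewrite setTI.
    apply: sub_sigma_algebra.
    exists (fun j => if j == k then B else setT), setT; split=> //.
      by move=> j; case: ifP.
    apply/seteqP; split=> [z zB|z [zB _]].
      by split=> // j; case: eqP => [->|].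
    by have := zB k; rewrite eqxx.
  move=> _ B mB; rewrite setTI; apply: sub_sigma_algebra.
  exists (fun=> setT), B; split=> //.
  by apply/seteqP; split=> [z zB|z [_ zB]].
by have := mid measurableT C mC; rewrite setTI.
Qed.

Lemma setI_closed_rectangles : setI_closed rectangles.
Proof.
move=> _ _ [A [B [mA mB ->]]] [A' [B' [mA' mB' ->]]].
exists (fun k => A k `&` A' k), (B `&` B'); split.
- by move=> k; exact: measurableI.
- exact: measurableI.
- apply/seteqP; split=> [z [[zA zB] [zA' zB']]|z [zA [zB zB']]].
    by split=> // k; split.
  by do 2!split=> //; move=> k; case: (zA k).
Qed.

Lemma eq_measure_rectangles (R : realType)
    (m1 m2 : {measure set (n.-tuple T * T) -> \bar R}) :
  (m1 setT < +oo)%E ->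
  (forall A B, (forall k, measurable (A k)) -> measurable B ->
    m1 (rectangle A B) = m2 (rectangle A B)) ->
  forall C, measurable C -> m1 C = m2 C.
Proof.
move=> m1T m12 C mC.
apply: (measure_unique rectangles (fun=> setT)) => //.
- exact: measurable_rectangles.
- exact: setI_closed_rectangles.
- by move=> _; exists (fun=> setT), setT; rewrite rectangleT; split.
- by rewrite bigcup_const.
- by move=> _ [A [B [mA mB ->]]]; exact: m12.
Qed.

End tuple_pair.

Section exchangeability.
Context d d' (Omega : measurableType d') (T : measurableType d) (R : realType).
Variables (P : probability Omega R) (nu : probability T R) (n : nat).
Variable X : 'I_n -> {RV P >-> T}.
Hypothesis indX : mutually_independent X.
Hypothesis distX : forall i A, measurable A -> distribution P (X i) A = nu A.

(** The fresh point gets index [ord_max]; under [P \x nu] all [n + 1] points are independent with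
    law [nu]. *)
Definition extended_sample (l : 'I_n.+1) (z : Omega * T) : T :=
  if unlift ord_max l is Some k then X k z.1 else z.2.

Lemma measurable_extended_sample l : measurable_fun setT (extended_sample l).
Proof.
rewrite /extended_sample; case: (unlift _ _) => [k|];
  last exact: measurable_snd.
by apply: (measurableT_comp (@measurable_funPT _ _ _ _ (X k)) measurable_fst).
Qed.

Lemma extended_sample_rectangle (C : 'I_n.+1 -> set T) :
  (forall l, measurable (C l)) ->
  (P \x nu)%E [set z | forall l, C l (extended_sample l z)] =
  (\prod_l nu (C l))%E.
Proof.
move=> mC.
rewrite (_ : [set z | _] =
  (\bigcap_(k in [set: 'I_n]) (X k @^-1` C (lift ord_max k))) `*` C ord_max).
  rewrite product_measure1E//; last first.
    apply: fin_bigcap_measurable => // k _.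
    by rewrite -[_ @^-1` _]setTI; exact: (@measurable_funPT _ _ _ _ (X k)).
  rewrite (bigD1_ord ord_max)//= muleC; congr (_ * _)%E.
  have := indX [set: 'I_n]%SET (fun k => mC (lift ord_max k)).
  rewrite (_ : [set` [set: 'I_n]%SET] = [set: 'I_n]); last first.
    by apply/seteqP; split=> k //= _; rewrite inE.
  move=> ->; apply: eq_big => [k|k _]; first by rewrite inE.
  exact: distX.
apply/seteqP; split=> [z zC|z [zX zm] l].
  split=> [k _|] /=.
    by have := zC (lift ord_max k); rewrite /extended_sample liftK.
  by have := zC ord_max; rewrite /extended_sample unlift_none.
rewrite /= /extended_sample; case: unliftP => [k ->|->] //.
exact: zX.
Qed.

Definition split_sample (i : 'I_n.+1) (z : Omega * T) : n.-tuple T * T :=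
  ([tuple extended_sample (lift i k) z | k < n], extended_sample i z).

Lemma measurable_split_sample i : measurable_fun setT (split_sample i).
Proof.
apply: measurable_fun_pair; last exact: measurable_extended_sample.
apply/measurable_fun_tnthP => k.
rewrite (_ : _ \o _ = extended_sample (lift i k)).
  exact: measurable_extended_sample.
by apply/funext => z /=; rewrite tnth_mktuple.
Qed.

HB.instance Definition _ i :=
  isMeasurableFun.Build _ _ _ _ (split_sample i) (measurable_split_sample i).

Lemma split_sample_rectangle i (A : 'I_n -> set T) B :
  (forall k, measurable (A k)) -> measurable B ->
  pushforward (P \x nu)%E (split_sample i) (rectangle A B) =
  (nu B * \prod_k nu (A k))%E.
Proof.
move=> mA mB.
pose C l := if unlift i l is Some k then A k else B.
have mC l : measurable (C l) by rewrite /C; case: (unlift _ _).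
have Ci : C i = B by rewrite /C unlift_none.
have Cl k : C (lift i k) = A k by rewrite /C liftK.
transitivity ((P \x nu)%E [set z | forall l, C l (extended_sample l z)]).
  rewrite /pushforward; congr (_ _); apply/seteqP; split=> z /=.
    move=> [zA zB] l; rewrite /C; case: unliftP => [k ->|->] //.
    by have := zA k; rewrite tnth_mktuple.
  move=> zC; split=> [k|] /=; last by rewrite -Ci.
  by rewrite tnth_mktuple -Cl.
rewrite extended_sample_rectangle// (bigD1_ord i)//= Ci; congr (_ * _)%E.
by apply: eq_bigr => k _; rewrite Cl.
Qed.

(** The law of [split_sample i] on rectangles does not depend on [i], hence neither does the law
    itself. *)
Lemma integral_split_sample (G : n.-tuple T * T -> R) i j :
  measurable_fun setT G -> (forall z, 0 <= G z) ->
  (\int[P \x nu]_z (G (split_sample i z))%:E =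
   \int[P \x nu]_z (G (split_sample j z))%:E)%E.
Proof.
move=> mG G0.
have mGE : measurable_fun setT (EFin \o G) by exact/measurable_EFinP.
have pE k : (\int[P \x nu]_z (G (split_sample k z))%:E =
    \int[distribution (P \x nu) (split_sample k)]_z (G z)%:E)%E.
  by rewrite (ge0_integral_distribution (P := (P \x nu)%E)).
rewrite !pE; apply: eq_measure_integral => A mA _.
apply: eq_measure_rectangles mA => [|B C mB mC].
  apply: (@le_lt_trans _ _ 1%E); last exact: ltry.
  by apply: probability_le1; exact: measurableT.
exact: etrans (split_sample_rectangle i mB mC)
              (esym (split_sample_rectangle j mB mC)).
Qed.

Lemma expectation_le_leave_one_out (G : n.-tuple T * T -> R) (c : R) :
  measurable_fun setT G -> (forall z, 0 <= G z) ->
  (forall y : 'I_n.+1 -> T,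
    \sum_(i < n.+1) G ([tuple y (lift i k) | k < n], y i) <= c) ->
  (\int[P]_w \int[nu]_x (G ([tuple X k w | k < n], x))%:E <=
   (c / n.+1%:R)%:E)%E.
Proof.
move=> mG G0 Gc.
have mGs i : measurable_fun setT (G \o split_sample i).
  exact: measurableT_comp (measurable_split_sample i).
have -> : (\int[P]_w \int[nu]_x (G ([tuple X k w | k < n], x))%:E =
           \int[P \x nu]_z (G (split_sample ord_max z))%:E)%E.
  rewrite fubini_tonelli1//; last first.
  - by move=> z; rewrite lee_fin.
  - by apply/measurable_EFinP; exact: mGs.
  apply: eq_integral => w _; apply: eq_integral => x _ /=.
  rewrite /split_sample {2}/extended_sample unlift_none/=.
  congr (G (_, _))%:E; apply: eq_from_tnth => k.
  by rewrite !tnth_mktuple /extended_sample liftK.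
set I := (\int[P \x nu]_z _)%E.
(* The [n + 1] copies of [I] may each hold out a different point, so [Gc] bounds their sum
   pointwise. *)
have S : (n.+1%:R%:E * I <= c%:E)%E.
  have -> : (n.+1%:R%:E * I =
      \sum_(i < n.+1) \int[P \x nu]_z (G (split_sample i z))%:E)%E.
    rewrite (eq_bigr (fun=> I)) => [|i _]; last exact: integral_split_sample.
    by rewrite sumr_const card_ord mule_natl.
  rewrite -ge0_integral_sum//; last 2 first.
  - by move=> i; apply/measurable_EFinP; exact: mGs.
  - by move=> i z _; rewrite lee_fin.
  apply: (@le_trans _ _ (\int[P \x nu]_z c%:E)%E).
    apply: le_integral_pointwise => z; rewrite sumEFin lee_fin.
    exact: (Gc (extended_sample ^~ z)).
  rewrite integral_cst// [X in (_ * X)%E](_ : _ = 1%E) ?mule1//.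
  exact: (@probability_setT _ _ _ (P \x nu)%E).
by rewrite mulrC EFinM lee_pdivlMl// ltr0n.
Qed.

End exchangeability.

(** * From the leave-one-out bound to the Kullback-Leibler risk *)

Lemma measurable_lnp (R : realType) : measurable_fun [set: R] (@lnp R).
Proof.
apply: (measurableT_comp (@measurable_ln R)).
by apply: measurable_maxr => //; apply: measurable_funM.
Qed.

Section KL_le_lnp.
Context d (T : measurableType d) (R : realType).
Variables (mu nu : {measure set T -> \bar R}) (f q : T -> R) (C : R).
Hypotheses (hf : prob_density mu f) (hq : prob_density mu q).
Hypothesis nuE : forall A, measurable A -> nu A = density_law mu f A.
Hypotheses (C0 : 0 <= C) (fq : forall x, f x <= C * q x).

Let mf : measurable_fun setT f. Proof. by case: hf. Qed.
Let mq : measurable_fun setT q. Proof. by case: hq. Qed.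
Let f0 x : 0 <= f x. Proof. by case: hf. Qed.
Let q0 x : 0 <= q x. Proof. by case: hq. Qed.
Let f1 : (\int[mu]_x (f x)%:E = 1)%E. Proof. by case: hf. Qed.
Let q1 : (\int[mu]_x (q x)%:E = 1)%E. Proof. by case: hq. Qed.

Let l x := lnp (f x / q x).

Lemma measurable_lnp_ratio : measurable_fun setT l.
Proof.
apply: (measurableT_comp (@measurable_lnp R)); apply: measurable_funM => //.
exact: (measurableT_comp (@measurable_invr R)).
Qed.

Let q_gt0 x : 0 < f x -> 0 < q x.
Proof.
move=> fx; rewrite lt_neqAle q0 andbT; apply/eqP => qx.
by have := fq x; rewrite -qx mulr0 leNgt fx.
Qed.

(** Boundedness of [l] makes [l * f] integrable, whatever the size of [C], which will depend on the
    sample. *)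
Let l_le x : l x <= ln (Num.max (expR 1 * C) 1).
Proof.
rewrite /l /lnp ler_ln ?posrE ?lt_max ?ltr01 ?orbT// ge_max.
rewrite !le_max lexx orbT andbT.
apply/orP; left; rewrite ler_wpM2l ?expR_ge0//.
have [qx|qx] := eqVneq (q x) 0; first by rewrite qx invr0 mulr0.
by rewrite ler_pdivrMr// lt_neqAle eq_sym qx q0.
Qed.

Let integral_l : (\int[nu]_x (l x)%:E = \int[mu]_x (l x * f x)%:E)%E.
Proof.
apply: ge0_integral_density_law => //; first exact: measurable_lnp_ratio.
by move=> x; exact: lnp_ge0.
Qed.

Lemma density_law_dominates : density_law mu f `<< density_law mu q.
Proof.
move=> N Nq A mA AN; have := Nq A mA AN; rewrite /density_law => qA.
apply/eqP; rewrite eq_le integral_ge0 ?andbT; last first.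
  by move=> x _; rewrite lee_fin.
rewrite -(mule0 C%:E) -qA -ge0_integralZl_EFin//; last 2 first.
- by move=> x _; rewrite lee_fin.
- by apply/measurable_EFinP; exact: measurable_funTS.
apply: ge0_le_integral => //.
- by move=> x _; rewrite lee_fin.
- by apply/measurable_EFinP; exact: measurable_funTS.
- under eq_fun do rewrite -EFinM.
  apply/measurable_EFinP; apply: measurable_funM => //.
  exact: measurable_funTS.
- by move=> x _; rewrite -EFinM lee_fin.
Qed.

(** Gibbs' inequality for [lnp]: where [f > 0], [l >= 1 + ln (f / q) >= 2 - q / f], so
    [2 f <= l f + q] everywhere. *)
Lemma integral_lnp_ge1 : (1 <= \int[nu]_x (l x)%:E)%E.
Proof.
rewrite integral_l.
have ml : measurable_fun setT (fun x => (l x * f x)%:E).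
  apply/measurable_EFinP; apply: measurable_funM => //.
  exact: measurable_lnp_ratio.
have : (\int[mu]_x (2 * f x)%:E <= \int[mu]_x ((l x * f x)%:E + (q x)%:E))%E.
  apply: le_integral_pointwise => x; rewrite -EFinD lee_fin.
  have := f0 x; rewrite le_eqVlt => /predU1P[<-|fx].
    by rewrite !mulr0 add0r.
  have qx := q_gt0 fx.
  have h1 := lnp_ge (divr_gt0 fx qx).
  have := ln_leB1 (divr_gt0 qx fx).
  rewrite -invf_div lnV ?posrE ?divr_gt0// => h2.
  have h3 : 2 - (f x / q x)^-1 <= l x by rewrite /l; lra.
  have : (2 - (f x / q x)^-1) * f x <= l x * f x by rewrite ler_pM2r.
  by rewrite invf_div mulrBl divfK ?gt_eqF//; lra.
rewrite ge0_integralD//; last 3 first.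
- by move=> x _; rewrite lee_fin mulr_ge0 ?lnp_ge0.
- by move=> x _; rewrite lee_fin.
- exact/measurable_EFinP.
under eq_integral do rewrite EFinM.
rewrite ge0_integralZl_EFin//; last 2 first.
- by move=> x _; rewrite lee_fin.
- exact/measurable_EFinP.
rewrite f1 q1 mule1; case: (\int[mu]_x _)%E => [r| |]//.
  by rewrite -EFinD !lee_fin; lra.
by move=> _; rewrite leey.
Qed.

Lemma KL_le_lnp : (KL mu f q <= \int[nu]_x (l x)%:E - 1)%E.
Proof.
rewrite /KL ifT; last by apply/asboolP; exact: density_law_dominates.
have If : mu.-integrable setT (fun x => (f x)%:E).
  apply/integrableP; split; first exact/measurable_EFinP.
  under eq_integral do rewrite gee0_abs ?lee_fin//.
  by rewrite f1 ltry.
have Il : mu.-integrable setT (fun x => (l x * f x)%:E).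
  set D := ln (Num.max (expR 1 * C) 1).
  apply: (@le_integrable _ _ _ _ _ _ _ (fun x => (D%:E * (f x)%:E)%E)) => //.
  - apply/measurable_EFinP; apply: measurable_funM => //.
    exact: measurable_lnp_ratio.
  - move=> x _; rewrite -EFinM !gee0_abs ?lee_fin ?mulr_ge0 ?lnp_ge0//.
    by rewrite ler_wpM2r// l_le.
  - exact: integrableZl.
rewrite integral_l -[X in (_ - X)%E]f1 -integralB//.
apply: le_integral_pointwise => x; rewrite -EFinB lee_fin.
have := f0 x; rewrite le_eqVlt => /predU1P[<-|fx].
  by rewrite !mul0r mulr0 subr0.
have := lnp_ge (divr_gt0 fx (q_gt0 fx)); rewrite -/(l x) => h.
have : (1 + ln (f x / q x)) * f x <= l x * f x by rewrite ler_pM2r.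
by lra.
Qed.

End KL_le_lnp.

(** * Measurability of the iterates in the data *)

Section measurable_estimator.
Context d (S : measurableType d) (R : realType) (N M : nat).
Variable F : S -> 'I_N -> 'I_M -> R.
Hypothesis mF : forall k j, measurable_fun setT (fun s => F s k j).

Lemma measurable_mix (a b : S -> 'I_M -> R) :
  (forall j, measurable_fun setT (fun s => a s j)) ->
  (forall j, measurable_fun setT (fun s => b s j)) ->
  measurable_fun setT (fun s => mix (a s) (b s)).
Proof. by move=> ma mb; apply: measurable_sum => j; exact: measurable_funM. Qed.

Lemma measurable_score (a : S -> 'I_M -> R) :
  (forall j, measurable_fun setT (fun s => a s j)) ->
  forall j, measurable_fun setT (fun s => score (F s) (a s) j).
Proof.
move=> ma j; apply: measurable_funD; last first.
  exact: (measurableT_comp (@measurable_invr R) (ma j)).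
apply: measurable_sum => k; apply: measurable_funM => //.
by apply: (measurableT_comp (@measurable_invr R)); exact: measurable_mix.
Qed.

Lemma measurable_near_opt e (a : S -> 'I_M -> R) :
  (forall j, measurable_fun setT (fun s => a s j)) ->
  measurable_fun setT (fun s => near_opt e (F s) (a s)).
Proof.
move=> ma; apply: (measurable_fun_bool true).
rewrite setTI (_ : _ @^-1` _ = \bigcap_(j in [set: 'I_M])
  [set s | score (F s) (a s) j <= N%:R + M%:R + e]).
  apply: fin_bigcap_measurable => // j _.
  rewrite -[X in measurable X]setTI.
  have := measurable_fun_ler (measurable_score ma j)
    (measurable_cst (N%:R + M%:R + e)).
  by move=> /(_ measurableT [set true]); apply.
apply/seteqP; split=> [s /forallP h j _|s h]; first exact: h.
by apply/forallP => j; exact: h.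
Qed.

Lemma measurable_em_iter e K j :
  measurable_fun setT (fun s => em_iter e (F s) K j).
Proof.
elim: K j => [|K IH] j; first exact: measurable_cst.
rewrite (_ : (fun s => _) = fun s =>
  if near_opt e (F s) (em_iter e (F s) K) then em_iter e (F s) K j
  else em (F s) (em_iter e (F s) K) j).
  apply: measurable_fun_ifT; [exact: measurable_near_opt|exact: IH|].
  apply: measurable_funM => //; apply: measurable_funM => //.
  exact: measurable_score.
by apply/funext => s; rewrite /em_iter iterS /em_step; case: ifP.
Qed.

End measurable_estimator.

(** * Mixture densities and positive rows *)

Section mixture_density.
Context d (T : measurableType d) (R : realType) (M : nat).
Variables (mu : {measure set T -> \bar R}) (p : 'I_M -> T -> R).
Hypothesis hp : forall j, prob_density mu (p j).

Lemma prob_density_mix c :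
  simplex c -> prob_density mu (fun x => mix c (p^~ x)).
Proof.
move=> [c0 c1]; have p0 j x : 0 <= p j x by case: (hp j).
have mp j : measurable_fun setT (p j) by case: (hp j).
split=> [|x|]; first by apply: measurable_mix.
  exact: mix_ge0.
under eq_integral do rewrite /mix -sumEFin.
rewrite ge0_integral_sum//; last 2 first.
- by move=> j; apply/measurable_EFinP; exact: measurable_funM.
- by move=> j x _; rewrite lee_fin mulr_ge0.
rewrite -c1 -sumEFin; apply: eq_bigr => j _.
under eq_integral do rewrite EFinM.
rewrite ge0_integralZl_EFin//; last 2 first.
- by move=> x _; rewrite lee_fin.
- exact/measurable_EFinP.
by case: (hp j) => _ _ ->; rewrite mule1.
Qed.

(* Points where all [p j] vanish get a row of ones, so that mixtures of the rows
   are always positive. *)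
Definition rows (x : T) (j : 'I_M) : R :=
  if \sum_i p i x == 0 then 1 else p j x.

Lemma measurable_rows j : measurable_fun setT (rows^~ j).
Proof.
have mp i : measurable_fun setT (p i) by case: (hp i).
apply: measurable_fun_ifT => //; apply: measurable_fun_eqr => //.
exact: measurable_sum.
Qed.

Lemma positive_rows_rows N (y : 'I_N -> T) : (0 < M)%N ->
  positive_rows (fun k => rows (y k)).
Proof.
move=> M0; have p0 j x : 0 <= p j x by case: (hp j).
split=> [k j|k]; first by rewrite /rows; case: ifP.
rewrite /rows; case: (eqVneq (\sum_i p i (y k)) 0) => h.
  by rewrite sumr_const card_ord ltr0n.
by rewrite lt_neqAle eq_sym h; apply: sumr_ge0.
Qed.

(** Where all densities vanish the left side is [lnp 0 = 0]; elsewhere the two sides agree. *)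
Lemma lnp_mix_le_rows (a c : 'I_M -> R) x : simplex a -> simplex c ->
  lnp (mix c (p^~ x) / mix a (p^~ x)) <= lnp (mix c (rows x) / mix a (rows x)).
Proof.
move=> [a0 a1] [c0 c1]; rewrite /rows.
case: (eqVneq (\sum_i p i x) 0) => // p00.
have -> : mix c (p^~ x) = 0.
  apply: big1 => j _; rewrite (_ : p j x = 0) ?mulr0//.
  move/eqP: p00; rewrite psumr_eq0; last by move=> i _; case: (hp i).
  by move=> /allP /(_ j (mem_index_enum _)) /eqP.
by rewrite mul0r /lnp mulr0 max_r// ln1; exact: lnp_ge0.
Qed.

End mixture_density.

(** * The estimator and its risk bound *)

Theorem corollary3 (R : realType) (M n : nat) (hM : (2 <= M)%N)
  (hn : (2 <= n)%N) (hn_even : ~~ odd n)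
  (d : measure_display) (T : measurableType d)
  (mu : {measure set T -> \bar R})
  (p : 'I_M -> T -> R) (hp : forall j, prob_density mu (p j)) :
  exists phat : n.-tuple T -> T -> R,
    density_estimator mu phat /\
    forall pstar : T -> R, mixtures p pstar ->
    forall (d' : measure_display) (Omega : measurableType d')
      (P : probability Omega R) (X : 'I_n -> {RV P >-> T}),
      iid_with_density mu pstar X ->
      (\int[P]_w KL mu pstar (phat [tuple X i w | i < n])
         <= (11 * 10 ^+ 6 * (M%:R / n%:R))%:E)%E.
Proof.
have M0 : (0 < M)%N by exact: ltnW.
have n0 : (0 < n)%N by exact: ltnW.
have mp j : measurable_fun setT (p j) by case: (hp j).
have p0 j x : 0 <= p j x by case: (hp j).
(* This tolerance makes the accumulated error [8 (n + 1) e] equal to one. *)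
pose e : R := (8 * n.+1%:R)^-1.
have e0 : 0 < e by rewrite invr_gt0 mulr_gt0// ltr0n.
have eN : 8 * n.+1%:R * e <= 1 by rewrite divff// gt_eqF// mulr_gt0// ltr0n.
have e6 : e <= 6^-1.
  rewrite lef_pV2 ?posrE// ?mulr_gt0 ?ltr0n//.
  have : (1 : R) <= n.+1%:R by rewrite ler1n.
  by lra.
have g0 : 0 < gain n M e by exact: gain_gt0.
pose K := Num.bound ((n%:R + M%:R) * ln M%:R / gain n M e).
have hK : (n%:R + M%:R) * ln M%:R < K%:R * gain n M e.
  rewrite -ltr_pdivrMr// archi_boundP// divr_ge0 ?mulr_ge0 ?ln_ge0//.
  - by rewrite ler1n.
  - exact: ltW.
pose theta (s : n.-tuple T) := em_iter e (fun k => rows p (tnth s k)) K.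
have theta_open s : open_simplex (theta s).
  by apply: em_iter_open => //; exact: positive_rows_rows.
have mtheta j : measurable_fun setT (fun s => theta s j).
  apply: (@measurable_em_iter _ (n.-tuple T) _ _ _
    (fun s k => rows p (tnth s k))) => k i.
  exact: (measurableT_comp (measurable_rows hp i) (measurable_tnth k)).
pose phat s x := mix (theta s) (p^~ x).
have mphat : measurable_fun [set: n.-tuple T * T] (fun z => phat z.1 z.2).
  apply: measurable_mix => j.
    exact: (measurableT_comp (mtheta j) measurable_fst).
  exact: (measurableT_comp (mp j) measurable_snd).
exists phat; split.
  by split=> // s; apply: prob_density_mix => //; exact: open_simplexW.
move=> _ [c [c0 c1 ->]] d' Omega P X [indX lawX].
have hc : simplex c by split.
have hf := prob_density_mix hp hc.
set f := fun x => _ in hf *.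
pose i0 : 'I_n := Ordinal n0.
(* The law of one observation turns [density_law mu f] into a bundled probability. *)
pose nu : probability T R := distribution P (X i0).
(* As [c j <= 1], this dominates every ratio [c j / theta s j]. *)
pose C s : R := \sum_j (theta s j)^-1.
have C0 s : 0 <= C s.
  by apply: sumr_ge0 => j _; rewrite invr_ge0 ltW//; case: (theta_open s).
have fq s x : f x <= C s * phat s x.
  have [t0 _] := theta_open s.
  rewrite /f /phat /mix mulr_sumr; apply: ler_sum => j _.
  rewrite mulrA ler_wpM2r//.
  have cj : c j <= 1.
    by rewrite -c1 [leRHS](bigD1 j)//= lerDl; apply: sumr_ge0.
  apply: (le_trans cj); rewrite -(mulVf (lt0r_neq0 (t0 j))) ler_pM2r//.
  rewrite /C (bigD1 j)//= lerDl; apply: sumr_ge0 => i _.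
  by rewrite invr_ge0 ltW.
have hq s : prob_density mu (phat s).
  by apply: prob_density_mix => //; exact: open_simplexW.
pose G (z : n.-tuple T * T) := lnp (f z.2 / phat z.1 z.2).
have mG : measurable_fun setT G.
  apply: (measurableT_comp (@measurable_lnp R)); apply: measurable_funM.
    by apply: (measurableT_comp _ measurable_snd); case: hf.
  exact: (measurableT_comp (@measurable_invr R)).
have G0 z : 0 <= G z by exact: lnp_ge0.
have Gsum (y : 'I_n.+1 -> T) :
    \sum_(i < n.+1) G ([tuple y (lift i k) | k < n], y i) <=
    n.+1%:R + 15 * M%:R.
  pose b (i : 'I_n.+1) := theta [tuple y (lift i k) | k < n].
  have hP := positive_rows_rows hp y M0.
  apply: le_trans (leave_one_out M0 hP e0 e6 eN (b := b) _ _ hc).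
  - apply: ler_sum => i _; apply: lnp_mix_le_rows => //.
    exact: open_simplexW.
  - by move=> i; exact: theta_open.
  - move=> i; rewrite /b /theta.
    rewrite (_ : (fun k => rows p (tnth _ k)) =
      (fun k => rows p (y (lift i k)))).
      by apply: em_iter_near_opt => //; exact: positive_rows_rows.
    by apply/funext => k; rewrite tnth_mktuple.
have lawnu i A : measurable A -> distribution P (X i) A = nu A.
  by move=> mA; exact: etrans (lawX i A mA) (esym (lawX i0 A mA)).
have main := expectation_le_leave_one_out indX lawnu mG G0 Gsum.
pose g w : \bar R := (\int[nu]_x (G ([tuple X k w | k < n], x))%:E)%E.
have g1 w : (1 <= g w)%E.
  by apply: (integral_lnp_ge1 hf (hq _) _ (fq _)) => A mA; exact: lawX.
have mY : measurable_fun setT (fun w => [tuple X k w | k < n]).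
  apply/measurable_fun_tnthP => k.
  rewrite (_ : _ \o _ = X k); first exact: measurable_funPT.
  by apply/funext => w /=; rewrite tnth_mktuple.
have mg : measurable_fun setT g.
  apply: (@measurable_fun_fubini_tonelli_F _ _ _ _ _ nu
    (fun z => (G ([tuple X k z.1 | k < n], z.2))%:E)).
    apply/measurable_EFinP; apply: (measurableT_comp mG).
    apply: measurable_fun_pair => //.
    exact: (measurableT_comp mY measurable_fst).
  by move=> z; rewrite lee_fin.
have g1_ge0 w : (0 <= g w - 1)%E by rewrite sube_ge0.
have mg1 : measurable_fun setT (fun w => g w - 1)%E.
  exact: emeasurable_funB.
apply: (@le_trans _ _ (\int[P]_w (g w - 1))%E).
  apply: le_integral_pointwise => w.
  by apply: (KL_le_lnp hf (hq _) _ (C0 _) (fq _)) => A mA; exact: lawX.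
(* One is added back to the nonnegative [g w - 1], where additivity holds even for infinite
   values. *)
have gE : (\int[P]_w g w = \int[P]_w (g w - 1) + 1)%E.
  rewrite -[X in (_ + X)%E](@probability_setT _ _ _ P) -[P setT]mul1e.
  rewrite -integral_cst// -ge0_integralD//.
  by apply: eq_integral => w _; rewrite subeK.
have : (\int[P]_w (g w - 1) + 1 <= ((n.+1%:R + 15 * M%:R) / n.+1%:R)%:E)%E.
  by rewrite -gE.
rewrite -leeBrDr// -EFinB => /le_trans; apply; rewrite lee_fin.
(* What remains is [15 M / (n + 1)], far below the claimed bound. *)
rewrite mulrDl divff ?pnatr_eq0// addrAC subrr add0r mulrA.
rewrite ler_pdivrMr ?ltr0n// mulrAC.
have n1 : 1 <= n.+1%:R / n%:R :> R.
  by rewrite ler_pdivlMr ?ltr0n// mul1r ler_nat.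
rewrite -mulrA; apply: (@le_trans _ _ (11 * 10 ^+ 6 * M%:R)).
  by rewrite ler_wpM2r//; lra.
by rewrite ler_peMr// !mulr_ge0.
Qed.
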